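(* Let $1\le p<\infty$ and let $Y,X$ be separable infinite dimensional Banach spaces. Assume there is a Borel reduction $r:2^\omega\to\mathrm{Emb}(Y,X)$ of $(2^\omega,E_0)$ to $(\mathrm{Emb}(Y,X),\sim)$ with the following properties: (a) $r(\alpha)$ is bounded uniformly on $\alpha\in2^\omega$; (b) there exists a sequence $(c_k)_k$ of integers such that for all $k$ and all $\alpha,\beta\in 2^\omega$, $\alpha E_0^k\beta\Rightarrow r(\alpha)\sim_{c_k}r(\beta)$; (c) there exists a sequence $(d_k)_k$ of integers tending to infinity such that for all $k$ and all $\alpha,\beta\in2^\omega$, if $\alpha$ and $\beta$ are not $E_0^k$-related and $\alpha(i)=0$ and $\beta(i)=1$ for some $i\ge k$, then there is no bounded linear map $T$ on $X$ of norm less than $d_k$ such that $T\,r(\alpha)=r(\beta)$. Then the relation $E_1$ is Borel reducible to $(\mathrm{Emb}(\ell_p(Y),\ell_p(X)),\sim)$ and to $(\mathrm{Emb}(c_0(Y),c_0(X)),\sim)$.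
   Context: For infinite dimensional separable Banach spaces $Y,X$, $\mathcal B(Y,X)$ is the set of bounded linear operators from $Y$ to $X$, a standard Borel space for the Borel structure generated by the strong operator topology. $\mathrm{Emb}(Y,X)$ is the Borel subset of $\mathcal B(Y,X)$ of those operators that are isomorphisms onto a closed subspace of infinite codimension in $X$. $GL(X)$ is the group of automorphisms of $X$. On $\mathrm{Emb}(Y,X)$: $T\sim U$ iff there exists $A\in GL(X)$ with $T=AU$; and for $n\in\mathbb N$, $U\sim_nV$ iff there is $T\in GL(X)$ with $TU=V$ and $\max\{\|T\|,\|T^{-1}\|\}\le n$. $\ell_p(Y)$ and $c_0(Y)$ denote the $\ell_p$-sum and the $c_0$-sum of countably infinitely many copies of $Y$. An equivalence relation $R$ on a standard Borel space $E$ is Borel reducible to $S$ on a standard Borel space $F$ if there is a Borel map $f:E\to F$ (a Borel reduction) with $xRy\Leftrightarrow f(x)Sf(y)$ for all $x,y\in E$. For $\alpha,\beta\in2^\omega$ and $k\in\mathbb N$, $\alpha E_0^k\beta$ means $\alpha(i)=\beta(i)$ for all $i\ge k$, and $\alpha E_0\beta$ means $\alpha E_0^k\beta$ for some $k$. $E_1$ is the relation of eventual agreement of sequences of reals: on $\mathbb R^{\mathbb N}$ (equivalently, up to Borel bireducibility, on $(2^\omega)^\omega$), $xE_1y$ iff there is $n$ with $x_m=y_m$ for all $m\ge n$. *)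

(* Defs.v *)
From HB Require Import structures.
From mathcomp Require Import all_boot all_order all_algebra.
From mathcomp Require Import all_classical all_reals all_analysis.

Set Implicit Arguments.
Unset Strict Implicit.
Unset Printing Implicit Defensive.

Import Order.TTheory GRing.Theory Num.Theory.
Import numFieldNormedType.Exports.

Local Open Scope classical_set_scope.
Local Open Scope ring_scope.

Lemma seq_space_complete (R : realType) (V : normedModType R)
    (Y : completeNormedModType R) (pr : nat -> V -> Y) :
  (forall n, {morph pr n : x y / x - y}) ->
  (forall n v, `|pr n v| <= `|v|) ->
  (forall (F : set_system V) (y : nat -> Y), ProperFilter F ->
     cauchy F -> (forall n, pr n z @[z --> F] --> y n) ->
     exists v, forall n, pr n v = y n) ->
  (forall (F : set_system V) (v x : V) (e : R), ProperFilter F ->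
     (forall n, pr n z @[z --> F] --> pr n v) ->
     (\forall z \near F, `|x - z| <= e) -> `|x - v| <= e) ->
  forall F : set_system V, ProperFilter F -> cauchy F -> cvg F.
Proof.
move=> prB pr_le pr_lim pr_bound F FF Fc.
have Fb : cauchy_ball F by exact/cauchy_ballP.
have prc n : cvg (pr n z @[z --> F]).
  apply: cauchy_cvg; apply/cauchy_ballP => e e0.
  have [[A B] /= [FA FB] AB] := Fb e e0.
  exists (pr n @` A, pr n @` B) => /=.
    by split; [apply: filterS FA|apply: filterS FB] => x Ax; exists x.
  move=> [_ _] /= [[a Aa <-] [b Bb <-]].
  have := AB (a, b) (conj Aa Bb); rewrite -!ball_normE /= => ab.
  by rewrite -prB (le_lt_trans (pr_le _ _)).
have [v hv] := pr_lim F (fun n => lim (pr n z @[z --> F])) FF Fc prc.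
apply/cvg_ex; exists v; apply/cvgrPdist_le => e e0.
have [[A B] /= [FA FB] AB] := Fb e e0.
apply: filterS FA => x Ax; rewrite distrC.
apply: (pr_bound F) => [n|]; first by rewrite hv; exact: prc.
apply: filterS FB => z Bz.
by have := AB (x, z) (conj Ax Bz); rewrite /= -ball_normE => /ltW.
Qed.

Lemma continuous_norm_powR (R : realType) (V : normedModType R) (p : R) :
  1 <= p -> continuous (fun v : V => `|v| `^ p).
Proof.
move=> p1 v; have p0 : 0 < p by exact: lt_le_trans p1.
have [->|v0] := eqVneq v 0.
  apply/cvgrPdist_le => e e0; rewrite normr0 powR0 ?gt_eqF//.
  near=> w; rewrite sub0r normrN ger0_norm ?powR_ge0//.
  have [->|w0] := eqVneq w 0; first by rewrite normr0 powR0 ?gt_eqF// ltW.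
  have w1 : `|w| <= Num.min 1 e.
    near: w; apply: cvgr0_norm_le; first exact: cvg_id.
    by rewrite lt_min ltr01 e0.
  rewrite le_min in w1; have /andP[w1' we] := w1.
  by apply: le_trans we; rewrite ge1r_powR// w1' normr_gt0 w0.
have cp : {for `|v|, continuous (fun x : R => x `^ p)}.
  apply: differentiable_continuous; apply/derivable1_diffP.
  by apply: derivable_powR; rewrite in_itv /= andbT normr_gt0.
exact: cvg_comp (@norm_continuous _ _ v) cp.
Unshelve. all: by end_near. Qed.

Definition lp_series (R : realType) (p : R) (Y : normedModType R)
  (y : nat -> Y) : \bar R := (\sum_(k <oo) (`|y k| `^ p)%:E)%E.

(* The proof of 1 <= p is a parameter so that the instances below, which
   depend on it, can be inferred. *)
Definition lp_seq (R : realType) (p : R) (p1 : 1 <= p) (Y : normedModType R) :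
  {pred nat -> Y} := fun y => `[< (lp_series p y < +oo)%E >].
Arguments lp_seq {R p} p1 Y _.

Record lp_sum (R : realType) (p : R) (p1 : 1 <= p) (Y : normedModType R) :=
  LpSum { lp_val :> nat -> Y; _ : lp_val \in lp_seq p1 Y }.

Definition lp_norm (R : realType) (p : R) (p1 : 1 <= p) (Y : normedModType R)
  (y : lp_sum p1 Y) : R := fine (lp_series p y) `^ p^-1.

Section lp_sum.
Context {R : realType} {p : R} (p1 : 1 <= p) (Y : completeNormedModType R).

Local Notation lp_series := (lp_series p).
Local Notation lp_seq := (lp_seq p1 Y).
Local Notation lp_sum := (lp_sum p1 Y).

HB.instance Definition _ := [isSub for (@lp_val R p p1 Y)].
HB.instance Definition _ := [Choice of lp_sum by <:].

Let p0 : 0 < p. Proof. exact: lt_le_trans p1. Qed.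
Let pN0 : p != 0. Proof. by rewrite gt_eqF. Qed.

Let lp_seqP (y : nat -> Y) : reflect (lp_series y < +oo)%E (y \in lp_seq).
Proof. exact: asboolP. Qed.

Let Nm (y : nat -> Y) : \bar R := (lp_series y `^ p^-1)%E.

Let series_ge0 (y : nat -> Y) : (0 <= lp_series y)%E.
Proof. by apply: nneseries_ge0 => n _ _; rewrite lee_fin powR_ge0. Qed.

Let NmE y : Nm y = ('N[counting]_p%:E[EFin \o (fun k => `|y k|%R)])%E.
Proof.
rewrite Lnorm_counting// /Nm /lp_series; congr (_ `^ _)%E.
by apply: eq_eseriesr => k _ /=; rewrite normr_id.
Qed.

Let Nm_lty y : (Nm y < +oo)%E = (lp_series y < +oo)%E.
Proof.
apply/idP/idP; first by apply: lty_poweRy; rewrite invr_neq0.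
exact: poweR_lty.
Qed.

Let ge0_mono (x y : \bar R) : (0 <= x)%E -> (x <= y)%E ->
  (x `^ p^-1 <= y `^ p^-1)%E.
Proof.
move=> x0 xy; apply: gt0_ler_poweR => //; rewrite ?invr_ge0 ?(ltW p0)//.
  by rewrite in_itv/= x0 leey.
by rewrite in_itv/= (le_trans x0 xy) leey.
Qed.

Let NmD (y z : nat -> Y) : (Nm (y \+ z)%R <= Nm y + Nm z)%E.
Proof.
have -> : (Nm y + Nm z = 'N[counting]_p%:E[EFin \o (fun k => `|y k|%R)] +
    'N[counting]_p%:E[EFin \o (fun k => `|z k|%R)])%E by rewrite -!NmE.
apply: le_trans; last by apply: minkowski_EFin => //.
rewrite Lnorm_counting//; apply: ge0_mono => //.
apply: lee_nneseries => k _; first by rewrite lee_fin powR_ge0.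
rewrite /= lee_fin ge0_ler_powR ?(ltW p0)// ?nnegrE// ger0_norm ?addr_ge0//.
exact: ler_normD.
Qed.

Let seriesZ (a : R) (y : nat -> Y) :
  lp_series (a \*: y) = ((`|a| `^ p)%:E * lp_series y)%E.
Proof.
rewrite /lp_series -nneseriesZl; last first.
  by move=> k _; rewrite lee_fin powR_ge0.
by apply: eq_eseriesr => k _ /=; rewrite normrZ powRM.
Qed.

Let lp_submod : submod_closed lp_seq.
Proof.
have lp0 : 0 \in lp_seq.
  apply/lp_seqP; rewrite /lp_series eseries0// => k _ _.
  by rewrite /= normr0 powR0.
split=> // a y z /lp_seqP ylt /lp_seqP zlt; apply/lp_seqP.
rewrite -Nm_lty; apply: le_lt_trans (NmD _ _) _.
rewrite lte_add_pinfty ?Nm_lty// seriesZ.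
by rewrite lte_mul_pinfty// ?lee_fin ?powR_ge0.
Qed.

HB.instance Definition _ := GRing.isSubmodClosed.Build _ _ lp_seq lp_submod.
HB.instance Definition _ := [SubChoice_isSubLmodule of lp_sum by <:].

Let lp_fin (y : lp_sum) : (lp_series y < +oo)%E.
Proof. by case: y => y /= /lp_seqP. Qed.

Let lp_fin_num (y : lp_sum) : lp_series y \is a fin_num.
Proof. by rewrite ge0_fin_numE. Qed.

Let lp_normE (y : lp_sum) : (lp_norm y)%:E = Nm y.
Proof. by rewrite /lp_norm -fine_poweR fineK// fin_num_poweR. Qed.

Let lp_normD (y z : lp_sum) : lp_norm (y + z) <= lp_norm y + lp_norm z.
Proof.
have le_EFin (a b c : R) (A B C : \bar R) : a%:E = A -> b%:E = B -> c%:E = C ->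
    (A <= B + C)%E -> a <= b + c by move=> <- <- <-.
exact: le_EFin (lp_normE (y + z)) (lp_normE y) (lp_normE z) (NmD y z).
Qed.

Let lp_normZ (a : R) (y : lp_sum) : lp_norm (a *: y) = `|a| * lp_norm y.
Proof.
rewrite /lp_norm [lp_series _](seriesZ a y) fineM//= powRM ?powR_ge0 ?fine_ge0//.
by rewrite -powRrM mulfV// powRr1.
Qed.

Let term_le (y : lp_sum) n : `|y n| <= lp_norm y.
Proof.
have -> : `|y n| = (`|y n| `^ p) `^ p^-1 by rewrite -powRrM mulfV// powRr1.
rewrite /lp_norm ge0_ler_powR ?nnegrE ?powR_ge0 ?fine_ge0 ?invr_ge0 ?(ltW p0)//.
rewrite -lee_fin fineK// /lp_series.
rewrite (nneseriesD1 (n := n))//.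
by apply: leeDl; apply: nneseries_ge0 => k _ _; rewrite lee_fin powR_ge0.
Qed.

Let lp_norm_eq0 (y : lp_sum) : lp_norm y = 0 -> y = 0.
Proof.
move=> y0; apply/val_inj/funext => n /=; apply/eqP.
by rewrite -normr_le0 -y0 term_le.
Qed.

HB.instance Definition _ :=
  Lmodule_isNormed.Build R lp_sum lp_normD lp_normZ lp_norm_eq0.

Let coord n (y : lp_sum) : Y := y n.

Let bound (F : set_system lp_sum) (y : nat -> Y) (x : lp_sum) (e : R) :
  ProperFilter F -> (forall n, coord n z @[z --> F] --> y n) ->
  (\forall z \near F, `|x - z| <= e) ->
  0 <= e /\ (lp_series (fun n => (x n - y n)%R) <= (e `^ p)%:E)%E.
Proof.
move=> FF Fy Fx; have e0 : 0 <= e.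
  by have [z] := filter_ex Fx; apply: le_trans.
split=> //; apply: lime_le.
  by apply: is_cvg_nneseries => *; rewrite lee_fin powR_ge0.
apply: nearW => N; rewrite sumEFin lee_fin.
have cv : \sum_(0 <= k < N) `|x k - coord k z| `^ p @[z --> F] -->
    \sum_(0 <= k < N) `|x k - y k| `^ p.
  elim: N => [|N IH].
    rewrite big_nil; under eq_cvg do rewrite big_nil.
    exact: cvg_cst.
  rewrite big_nat_recr//=; under eq_cvg do rewrite big_nat_recr//=.
  apply: cvgD => //.
  have c : {for x N - y N, continuous (fun v : Y => `|v| `^ p)}.
    exact: continuous_norm_powR.
  apply: (continuous_cvg _ c).
  by apply: cvgB; [exact: cvg_cst|exact: Fy].
apply: (@closed_cvg _ _ F _ _ [set r : R | r <= e `^ p]) cv => //=.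
apply: filterS Fx => z xz.
apply: (@le_trans _ _ (`|x - z| `^ p)); last first.
  by rewrite ge0_ler_powR ?nnegrE ?(ltW p0).
rewrite /Num.norm/= /lp_norm -powRrM mulVf// powRr1 ?fine_ge0//.
rewrite -lee_fin fineK// -sumEFin.
by apply: nneseries_lim_ge => *; rewrite lee_fin powR_ge0.
Qed.

Let lp_complete (F : set_system lp_sum) :
  ProperFilter F -> cauchy F -> cvg F.
Proof.
apply: (@seq_space_complete R lp_sum Y coord).
- by [].
- by move=> n v; exact: term_le.
- move=> {}F y FF Fc Fy.
  have Fb : cauchy_ball F by exact/cauchy_ballP.
  have [[A B] /= [FA FB] AB] := Fb 1 ltr01.
  have [x Ax] := filter_ex FA.
  have xF : \forall z \near F, `|x - z| <= 1.
    apply: filterS FB => z Bz.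
    by have := AB (x, z) (conj Ax Bz); rewrite /= -ball_normE => /ltW.
  have [_ xy] := bound FF Fy xF.
  have xy' : (fun n => x n - y n) \in lp_seq.
    by apply/lp_seqP; apply: le_lt_trans xy _; rewrite ltry.
  exists (x - LpSum xy') => n; rewrite /coord /=.
  by rewrite opprB addrC subrK.
- move=> {}F v x e FF Fv Fx.
  have [e0 xv] := bound FF Fv Fx.
  rewrite -lee_fin [leLHS](lp_normE (x - v)).
  have -> : e%:E = ((e `^ p)%:E `^ p^-1)%E.
    by rewrite poweR_EFin -powRrM mulfV// powRr1.
  exact: ge0_mono.
Qed.

HB.instance Definition _ := Uniform_isComplete.Build lp_sum lp_complete.

End lp_sum.

Definition c0_seq (R : realType) (Y : normedModType R) : {pred nat -> Y} :=
  fun y => `[< y n @[n --> \oo] --> (0 : Y) >].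

Record c0_sum (R : realType) (Y : normedModType R) :=
  C0Sum { c0_val :> nat -> Y; _ : c0_val \in @c0_seq R Y }.

Definition c0_norm (R : realType) (Y : normedModType R) (y : c0_sum Y) : R :=
  sup (range (fun n => `|y n|)).

Section c0_sum.
Context {R : realType} (Y : completeNormedModType R).

Local Notation c0_seq := (@c0_seq R Y).
Local Notation c0_sum := (c0_sum Y).

HB.instance Definition _ := [isSub for (@c0_val R Y)].
HB.instance Definition _ := [Choice of c0_sum by <:].

Let c0_seqP (y : nat -> Y) :
  reflect (y n @[n --> \oo] --> (0 : Y)) (y \in c0_seq).
Proof. exact: asboolP. Qed.

Let c0_submod : submod_closed c0_seq.
Proof.
split=> [|a y z /c0_seqP y0 /c0_seqP z0]; apply/c0_seqP; first exact: cvg_cst.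
have -> : 0 = a *: 0 + 0 :> Y by rewrite scaler0 addr0.
by apply: cvgD => //; apply: cvgZr.
Qed.

HB.instance Definition _ := GRing.isSubmodClosed.Build _ _ c0_seq c0_submod.
HB.instance Definition _ := [SubChoice_isSubLmodule of c0_sum by <:].

Let c0_cvg (y : c0_sum) : y n @[n --> \oo] --> (0 : Y).
Proof. by case: y => y /= /c0_seqP. Qed.

Let range_sup (y : c0_sum) : has_sup (range (fun n => `|y n|)).
Proof.
split; first by exists `|y 0|; exists 0%N.
have /cvg_seq_bounded[M [_ My]] : cvg (y n @[n --> \oo]).
  by apply/cvg_ex; exists 0; exact: c0_cvg.
exists (M + 1) => _ [n _ <-]; apply: My => //.
by rewrite ltrDl.
Qed.

Let term_le (y : c0_sum) n : `|y n| <= c0_norm y.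
Proof. by apply: sup_upper_bound; [exact: range_sup|exists n]. Qed.

Let norm_le (y : c0_sum) (M : R) :
  (forall n, `|y n| <= M) -> c0_norm y <= M.
Proof.
by move=> yM; apply: ge_sup; [exists `|y 0|; exists 0%N|move=> _ [n _ <-]].
Qed.

Let c0_normD (y z : c0_sum) : c0_norm (y + z) <= c0_norm y + c0_norm z.
Proof.
apply: norm_le => n; apply: le_trans (ler_normD _ _) _.
by apply: lerD; exact: term_le.
Qed.

Let c0_normZ (a : R) (y : c0_sum) : c0_norm (a *: y) = `|a| * c0_norm y.
Proof.
have le b (z : c0_sum) : c0_norm (b *: z) <= `|b| * c0_norm z.
  apply: norm_le => n; rewrite [leLHS](normrZ b (z n)).
  by apply: ler_wpM2l; [exact: normr_ge0|exact: term_le].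
apply/eqP; rewrite eq_le le /=.
have [->|a0] := eqVneq a 0.
  rewrite normr0 mul0r; apply: le_trans (term_le _ 0%N); exact: normr_ge0.
rewrite -ler_pdivlMl ?normr_gt0// -normfV.
by apply: le_trans (le _ _); rewrite scalerA mulVf// scale1r.
Qed.

Let c0_norm_eq0 (y : c0_sum) : c0_norm y = 0 -> y = 0.
Proof.
move=> y0; apply/val_inj/funext => n /=; apply/eqP.
by rewrite -normr_le0 -y0 term_le.
Qed.

HB.instance Definition _ :=
  Lmodule_isNormed.Build R c0_sum c0_normD c0_normZ c0_norm_eq0.

Let coord n (y : c0_sum) : Y := y n.

Let bound (F : set_system c0_sum) (y : nat -> Y) (x : c0_sum) (e : R) :
  ProperFilter F -> (forall n, coord n z @[z --> F] --> y n) ->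
  (\forall z \near F, `|x - z| <= e) -> forall n, `|x n - y n| <= e.
Proof.
move=> FF Fy Fx n.
have cv : `|x n - coord n z| @[z --> F] --> `|x n - y n|.
  by apply: cvg_norm; apply: cvgB; [exact: cvg_cst|exact: Fy].
apply: (@closed_cvg _ _ F _ _ [set r : R | r <= e]) cv => //=.
by apply: filterS Fx => z; apply: le_trans; exact: (term_le (x - z)).
Qed.

Let c0_complete (F : set_system c0_sum) :
  ProperFilter F -> cauchy F -> cvg F.
Proof.
apply: (@seq_space_complete R c0_sum Y coord).
- by [].
- by move=> n v; exact: term_le.
- move=> {}F y FF Fc Fy.
  have Fb : cauchy_ball F by exact/cauchy_ballP.
  suff y0 : y \in c0_seq by exists (C0Sum y0).
  apply/c0_seqP/cvgrPdist_le => e e0.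
  have e2 : 0 < e / 2 by rewrite divr_gt0.
  have [[A B] /= [FA FB] AB] := Fb _ e2.
  have [x Ax] := filter_ex FA.
  have xF : \forall z \near F, `|x - z| <= e / 2.
    apply: filterS FB => z Bz.
    by have := AB (x, z) (conj Ax Bz); rewrite /= -ball_normE => /ltW.
  have xy := bound FF Fy xF.
  have /cvgrPdist_le/(_ _ e2) := c0_cvg x.
  apply: filterS => n; rewrite !sub0r !normrN => xn.
  rewrite -[y n](subrK (x n)) (splitr e) (le_trans (ler_normD _ _))//.
  by rewrite lerD// distrC.
- move=> {}F v x e FF Fv Fx.
  by apply: norm_le => n; exact: (bound FF Fv Fx).
Qed.

HB.instance Definition _ := Uniform_isComplete.Build c0_sum c0_complete.

End c0_sum.

Definition separable_space (T : topologicalType) :=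
  exists2 D : set T, countable D & dense D.

Definition infinite_codim (R : realType) (V : lmodType R) (W : set V) :=
  forall s : seq V, ~ forall v, exists2 w, W w &
    exists c : nat -> R, v = w + \sum_(i < size s) c i *: s`_i.

Definition infinite_dim (R : realType) (V : lmodType R) :=
  infinite_codim [set 0 : V].

Section operators.
Context {R : realType}.
Implicit Types X Y : normedModType R.

(* Operators are elements of {ptws Y -> X}, whose topology is that of
   pointwise convergence: the topology it induces on a set of bounded
   operators is the strong operator topology. *)
Definition bounded_op Y X : set {ptws Y -> X} :=
  [set T : Y -> X | linear T /\ exists M : R, forall y, `|T y| <= M * `|y| ].

Definition op_norm Y X (T : Y -> X) : R :=
  sup [set `|T y| | y in [set y | `|y| <= 1]].

Definition Emb Y X : set {ptws Y -> X} :=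
  [set T : Y -> X | [/\ bounded_op T,
    exists2 S : X -> Y, cancel T S & {within range T, continuous S},
    closed (range T) & infinite_codim (range T)]].
Arguments Emb Y X _ : clear implicits.

Definition inverse_ops X (A B : X -> X) :=
  [/\ bounded_op A, bounded_op B, cancel A B & cancel B A].

Definition GL X : set (X -> X) := [set A | exists B, inverse_ops A B].

Definition emb_equiv Y X (T U : Emb Y X) :=
  exists2 A, GL A & \val T = A \o \val U.

Definition emb_equivn Y X (n : nat) (U V : Emb Y X) :=
  exists T T' : X -> X, [/\ inverse_ops T T', T \o \val U = \val V &
    Num.max (op_norm T) (op_norm T') <= n%:R].

End operators.
Arguments Emb {R} Y X _.

Definition borel_set (T : topologicalType) : set (set T) := <<s @open T >>.

Definition borel_fun (T U : topologicalType) (f : T -> U) :=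
  forall B, borel_set B -> borel_set (f @^-1` B).

Definition borel_reduction (T U : topologicalType) (E : T -> T -> Prop)
    (F : U -> U -> Prop) (f : T -> U) :=
  borel_fun f /\ forall x y, E x y <-> F (f x) (f y).

Definition borel_reducible (T U : topologicalType) (E : T -> T -> Prop)
    (F : U -> U -> Prop) := exists f, borel_reduction E F f.

Definition E0k (k : nat) (a b : cantor_space) :=
  forall i, (k <= i)%N -> a i = b i.

Definition E0 (a b : cantor_space) := exists k, E0k k a b.

Definition E1 (R : realType) (x y : {ptws nat -> R}) :=
  exists n, forall m, (n <= m)%N -> x m = y m.

(* Main.v *)
Require Import Defs.
From HB Require Import structures.
From mathcomp Require Import all_boot all_order all_algebra.
From mathcomp Require Import all_classical all_reals all_analysis.

Set Implicit Arguments.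
Unset Strict Implicit.
Unset Printing Implicit Defensive.

Import Order.TTheory GRing.Theory Num.Theory.
Import numFieldNormedType.Exports.

Local Open Scope classical_set_scope.
Local Open Scope ring_scope.

(* Only [U = r(0)] and [V_i = r(e_i)], with [e_i] the sequence whose only 1 is
   at [i], are needed.  By (b) each [V_i] is [T_i U] for a bounded [T_i]; by
   (c) a bounded [T] with [T U = V_i] has norm at least [d_i].  A sequence [x]
   of reals is coded by the bits [b_n = (x_i < q)], where [n] ranges over codes
   of pairs [(i, q)] with [q] rational, and is sent to the operator
     [y |-> (U y_0, b_0 V_i(0) y_0, U y_1, b_1 V_i(1) y_1, ...)].
   It is bounded below because [U] is, and depends continuously on the bits.
   If [x] and [x'] agree from [N] on, then the two operators differ by an
   invertible shear, whose entries are [0] or [T_i], up to sign, with [i < N].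
   Conversely an operator [A] carrying one to the other, when the [n]-th bits
   are 0 and 1, has the entry from place [2n] to place [2n+1] mapping [U] to
   [V_i]; so [d_i <= ||A||], which bounds [i].  The argument is the same for
   l_p and c_0: it only uses that such sums are stable under coordinatewise
   domination along an injection of the indices. *)

(** * Linear operators, the operator norm and embeddings *)

Lemma linear_prop0 (R : realType) (V W : lmodType R) (f : V -> W) :
  linear f -> f 0 = 0.
Proof.
by move=> fl; have := fl (-1) 0 0; rewrite scaler0 addr0 scaleN1r addNr.
Qed.

Lemma linear_propD (R : realType) (V W : lmodType R) (f : V -> W) :
  linear f -> {morph f : u v / u + v}.
Proof. by move=> fl u v; have := fl 1 u v; rewrite !scale1r. Qed.

Lemma linear_propZ (R : realType) (V W : lmodType R) (f : V -> W) a :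
  linear f -> {morph f : u / a *: u}.
Proof.
by move=> fl u; rewrite -[a *: u]addr0 fl (linear_prop0 fl) addr0.
Qed.

Lemma linear_propB (R : realType) (V W : lmodType R) (f : V -> W) :
  linear f -> {morph f : u v / u - v}.
Proof. by move=> fl u v; rewrite addrC -scaleN1r fl scaleN1r addrC. Qed.

Lemma le_op_norm (R : realType) (Y X : normedModType R) (T : Y -> X) (y : Y) :
  bounded_op T -> `|T y| <= op_norm T * `|y|.
Proof.
move=> [Tl [M TM]].
have T0 := linear_prop0 Tl; have TZ a := linear_propZ a Tl.
have [->|y0] := eqVneq y 0; first by rewrite T0 !normr0 mulr0.
have y0' : 0 < `|y| by rewrite normr_gt0.
rewrite -ler_pdivrMr// mulrC.
have -> : `|y|^-1 * `|T y| = `|T (`|y|^-1 *: y)|.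
  by rewrite TZ normrZ normfV normr_id.
apply: sup_upper_bound; last first.
  exists (`|y|^-1 *: y) => //=.
  by rewrite normrZ normfV normr_id mulVf// gt_eqF.
split; first by exists `|T 0|, 0; rewrite //= normr0.
exists `|M| => _ [z /= z1 <-]; apply: le_trans (TM z) _.
apply: le_trans (ler_wpM2r (normr_ge0 _) (ler_norm M)) _.
by rewrite ler_piMr.
Qed.

Lemma op_norm_le (R : realType) (Y X : normedModType R) (T : Y -> X) (K : R) :
  0 <= K -> (forall y, `|T y| <= K * `|y|) -> op_norm T <= K.
Proof.
move=> K0 TK; apply: ge_sup; first by exists `|T 0|, 0; rewrite //= normr0.
move=> _ [z /= z1 <-]; apply: le_trans (TK z) _.
by rewrite ler_piMr.
Qed.

(** The inverse of [T] on its range is continuous at 0, hence of norm less than 1 on the points of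
    the range in some ball of radius [d]; scaling gives the constant [2 / d]. *)
Lemma Emb_bounded_below (R : realType) (Y X : normedModType R) (T : Y -> X) :
  Emb Y X T -> exists2 K : R, 0 < K & forall y, `|y| <= K * `|T y|.
Proof.
move=> [[Tl _] [S TS /subspace_continuousP Sc] _ _].
have T0 := linear_prop0 Tl; have TZ a := linear_propZ a Tl.
have S0 : S 0 = 0 by rewrite -T0 TS.
have R0 : range T 0 by exists 0.
have /cvgrPdist_lt/(_ 1 ltr01) S1 := Sc 0 R0.
have /nbhs_ballP[d /= d0 dS] :
  nbhs (0 : X) [set x | range T x -> `|S 0 - S x| < 1] := S1.
exists (2 / d); first by rewrite divr_gt0.
move=> y; have [Ty0|Ty0] := eqVneq (T y) 0.
  have -> : y = 0 by rewrite -(TS y) Ty0.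
  by rewrite T0 !normr0 mulr0.
have Ty : 0 < `|T y| by rewrite normr_gt0.
(* With this factor [T (t *: y)] has norm [d / 2], inside the ball. *)
pose t := d / (2 * `|T y|).
have t0 : 0 < t by rewrite divr_gt0// mulr_gt0.
have : `|S 0 - S (T (t *: y))| < 1.
  apply: dS; last by exists (t *: y).
  rewrite -ball_normE /= sub0r normrN TZ normrZ gtr0_norm// /t.
  rewrite invfM mulrA mulfVK ?gt_eqF//.
  by rewrite ltr_pdivrMr// ltr_pMr// ltr1n.
rewrite S0 TS sub0r normrN normrZ gtr0_norm// mulrC -ltr_pdivlMr// => /ltW.
by rewrite mul1r /t invf_div mulrAC.
Qed.

(** A lower bound makes [T] injective with a Lipschitz inverse on its range, and completeness of [Y]
    then makes the range closed. *)
Lemma Emb_of_bounded_below (R : realType) (Y : completeNormedModType R)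
    (X : normedModType R) (T : Y -> X) (K : R) :
  bounded_op T -> (forall y, `|y| <= K * `|T y|) -> infinite_codim (range T) ->
  Emb Y X T.
Proof.
move=> Tb TK Tcodim; have [Tl [M TM]] := Tb.
have TB := linear_propB Tl.
have K1 : 0 < `|K| + 1 by rewrite ltr_wpDl.
have {}TK y : `|y| <= (`|K| + 1) * `|T y|.
  apply: le_trans (TK y) _; apply: ler_wpM2r => //.
  by apply: le_trans (ler_norm K) _; rewrite lerDl.
move: (`|K| + 1) K1 TK => {}K K0 TK.
have Tinj y z : T y = T z -> y = z.
  move=> yz; apply/eqP; rewrite -subr_eq0 -normr_le0.
  by apply: le_trans (TK _) _; rewrite TB yz subrr normr0 mulr0.
have [S Sr] : exists S : X -> Y, forall x, range T x -> T (S x) = x.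
  suff /choice[S SP] : forall x, exists y, range T x -> T y = x by exists S.
  by move=> x; case: (pselect (range T x)) => [[y _ <-]|]; [exists y|exists 0].
have TS : cancel T S by move=> y; apply: Tinj; apply: Sr; exists y.
split => //.
- exists S => //; apply/subspace_continuousP => _ [y _ <-].
  apply/cvgrPdist_lt => e e0.
  suff : nbhs (T y) [set z | range T z -> `|S (T y) - S z| < e] by [].
  rewrite TS.
  apply/nbhs_ballP; exists (e / K) => /=; first by rewrite divr_gt0.
  move=> z; rewrite -ball_normE /= => yz Rz.
  apply: le_lt_trans (TK _) _; rewrite TB Sr//.
  by rewrite mulrC -ltr_pdivlMr.
(* The range is closed: the trace [F] on it of the neighbourhoods of a point [x] of its closure is
   sent by [S] to a Cauchy filter, whose limit [y] satisfies [T y = x]. *)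
- move=> x xcl; pose F := within (range T) (nbhs x).
  have FF : ProperFilter F.
    apply: Build_ProperFilter_ex => A FA.
    have [z [Rz Az]] := xcl _ FA.
    by exists z; exact: Az.
  have RF : F (range T) by exact: withinT.
  have cvF : S z @[z --> F] --> lim (S z @[z --> F]).
    apply: cauchy_cvg; apply/cauchy_ballP => e e0.
    pose B := ball x (e / K / 2).
    have FB : F (B `&` range T).
      apply: filterI => //; apply: (@filterS _ (nbhs x) _ B) => //.
      by apply: nbhsx_ballx; rewrite !divr_gt0.
    exists (S @` (B `&` range T), S @` (B `&` range T)) => /=.
      by split; apply: filterS FB => z Bz; exists z.
    move=> [_ _] /= [[a [Ba Ra] <-] [b [Bb Rb] <-]].
    rewrite -ball_normE /=; apply: le_lt_trans (TK _) _.
    rewrite TB !Sr// mulrC -ltr_pdivlMr//.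
    have := ball_splitr Ba Bb; by rewrite -ball_normE.
  exists (lim (S z @[z --> F])) => //; set y := lim _ in cvF *.
  have TSF : T (S z) @[z --> F] --> T y.
    apply/cvgrPdist_lt => e e0.
    have M1 : 0 < `|M| + 1 by rewrite ltr_wpDl.
    move/cvgrPdist_lt/(_ (e / (`|M| + 1))) : cvF.
    rewrite divr_gt0// => /(_ isT).
    apply: filterS => z yz; rewrite -TB.
    apply: (@le_lt_trans _ _ ((`|M| + 1) * `|y - S z|)).
      apply: le_trans (TM _) _; apply: ler_wpM2r => //.
      by apply: le_trans (ler_norm _) _; rewrite lerDl.
    by rewrite mulrC -ltr_pdivlMr.
  have idF : T (S z) @[z --> F] --> x.
    apply: (@cvg_trans _ F); last exact: cvg_within.
    apply: (@near_eq_cvg _ _ F _ id); apply: filterS RF => z Rz.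
    by rewrite /= Sr.
  exact: (cvg_unique _ TSF idF).
Qed.

(** * Sequence spaces and domination; the cases of l_p and c_0 *)

(* [c u n] is the [n]-th coordinate of [u]: [E] is regarded as a space of
   [Y]-valued sequences. *)
Record sequence_space (R : realType) (Y E : normedModType R)
    (c : E -> nat -> Y) : Prop := SequenceSpace {
  coord_linear : forall n, linear (c^~ n) ;
  coord_inj : forall u v, c u =1 c v -> u = v ;
  coord_le : forall u n, `|c u n| <= `|u| ;
  coord_single : forall n a, exists2 u, `|u| <= `|a| &
    forall m, c u m = if m == n then a else 0 ;
  coord_tail : forall u e, 0 < e -> exists k, exists2 v, `|v| <= e &
    forall n, c v n = if (n < k)%N then 0 else c u n }.
Arguments coord_linear {R Y E c}.
Arguments coord_inj {R Y E c}.
Arguments coord_le {R Y E c}.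
Arguments coord_single {R Y E c}.
Arguments coord_tail {R Y E c}.

(** Injectivity of [h] is asked only on the support of [z], so that [half], which is two-to-one, is
    allowed for sequences supported on the odd or on the even places. *)
Definition dominates (R : realType) (Y X EY EX : normedModType R)
    (cY : EY -> nat -> Y) (cX : EX -> nat -> X) :=
  forall (u : EY) (z : nat -> X) (h : nat -> nat) (K : R), 0 <= K ->
    {in [pred n | z n != 0] &, injective h} ->
    (forall n, `|z n| <= K * `|cY u (h n)|) ->
  exists2 v, `|v| <= K * `|u| & cX v =1 z.

(** Up to order, [s] is a subfamily of an initial segment, whose sum is a partial sum of the
    series. *)
Lemma sum_uniq_le_nneseries (R : realType) (f : nat -> \bar R) (s : seq nat) :
  (forall n, (0 <= f n)%E) -> uniq s ->
  (\sum_(n <- s) f n <= \sum_(n <oo) f n)%E.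
Proof.
move=> f0 us; pose J := (\max_(j <- s) j).+1.
have ps : perm_eq s [seq j <- index_iota 0 J | j \in s].
  apply: uniq_perm => //; first by rewrite filter_uniq// iota_uniq.
  move=> j; rewrite mem_filter mem_index_iota /=.
  by case js : (j \in s) => //=; rewrite ltnS (@leq_bigmax_seq _ s xpredT id).
rewrite (perm_big _ ps) big_filter.
apply: le_trans (nneseries_lim_ge J _) => //.
by rewrite big_mkcond /=; apply: lee_sum => j _; case: ifP.
Qed.

Lemma le_of_powR_le (R : realType) (p a b : R) : 0 < p -> 0 <= a -> 0 <= b ->
  a `^ p <= b `^ p -> a <= b.
Proof.
move=> p0 a0 b0; rewrite leNgt [a <= b]leNgt; apply: contra => ba.
by rewrite gt0_ltr_powR.
Qed.

Lemma lp_norm_powR (R : realType) (p : R) (p1 : 1 <= p)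
    (Y : completeNormedModType R) (u : lp_sum p1 Y) :
  (`|u| `^ p)%:E = lp_series p u.
Proof.
have p0 : 0 < p by exact: (lt_le_trans ltr01 p1).
have s0 : (0 <= lp_series p u)%E.
  by apply: nneseries_ge0 => n _ _; rewrite lee_fin powR_ge0.
rewrite /Num.norm /= /lp_norm -powRrM mulVf ?gt_eqF// powRr1 ?fine_ge0//.
by rewrite fineK// ge0_fin_numE//; case: u {s0} => u /= /asboolP.
Qed.

Lemma lp_sum_of_series_le (R : realType) (p : R) (p1 : 1 <= p)
    (X : completeNormedModType R) (z : nat -> X) (K : R) : 0 <= K ->
  (lp_series p z <= (K `^ p)%:E)%E ->
  exists2 v : lp_sum p1 X, `|v| <= K & lp_val v =1 z.
Proof.
move=> K0 zK; have p0 : 0 < p by exact: (lt_le_trans ltr01 p1).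
have zin : z \in lp_seq p1 X by apply/asboolP; apply: le_lt_trans zK (ltry _).
exists (LpSum zin) => //.
have := zK; rewrite -[lp_series p z](lp_norm_powR (LpSum zin)) lee_fin.
exact: (le_of_powR_le p0 (normr_ge0 _) K0).
Qed.

Lemma lp_sequence_space (R : realType) (p : R) (p1 : 1 <= p)
    (Y : completeNormedModType R) :
  sequence_space (@lp_val R p p1 Y).
Proof.
have p0 : 0 < p by exact: (lt_le_trans ltr01 p1).
have pw0 (t : R) : (0 <= (t `^ p)%:E)%E by rewrite lee_fin powR_ge0.
split.
- by [].
- by move=> u v uv; apply/val_inj/funext.
- move=> u n.
  have : ((`|u n| `^ p)%:E <= (`|u| `^ p)%:E)%E.
    rewrite lp_norm_powR /lp_series (nneseriesD1 (n := n))//.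
    by apply: leeDl; apply: nneseries_ge0.
  rewrite lee_fin.
  exact: (le_of_powR_le p0 (normr_ge0 _) (normr_ge0 _)).
- move=> n a; apply: lp_sum_of_series_le => //.
  rewrite /lp_series (nneseriesD1 (n := n))// eqxx eseries0 ?adde0//.
  by move=> i _ /= /negbTE ->; rewrite normr0 powR0// gt_eqF.
- move=> u e e0.
  (* The tails of a convergent series tend to 0: some [k] makes the tail at most the [p]-th power of
     [e]. *)
  have uoo : (\sum_(k <oo) (`|u k| `^ p)%:E < +oo)%E.
    by rewrite -[X in (X < _)%E]/(lp_series p u) -lp_norm_powR ltry.
  have /= /fine_cvg/cvgr0Pnorm_le :=
    nneseries_tail_cvg uoo (fun k _ => pw0 _).
  move=> /(_ (e `^ p)); rewrite powR_gt0// => /(_ isT)[k _ /(_ k (leqnn k))].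
  rewrite /= => tk; exists k.
  apply: lp_sum_of_series_le; first exact: ltW.
  have tfin : (\sum_(k <= j <oo) (`|u j| `^ p)%:E)%E \is a fin_num.
    rewrite ge0_fin_numE ?nneseries_ge0//; apply: le_lt_trans uoo.
    rewrite [leRHS](nneseries_split 0 k)// add0n leeDr//.
    by apply: sume_ge0.
  have -> : lp_series p (fun n => if (n < k)%N then 0 else u n) =
      (\sum_(k <= j <oo) (`|u j| `^ p)%:E)%E.
    rewrite eseries_cond eseries_mkcond /lp_series; apply: eq_eseriesr => j _.
    rewrite /= ltnNge; case: (k <= j)%N => //=.
    by rewrite normr0 powR0// gt_eqF.
  by rewrite -(fineK tfin) lee_fin (le_trans (ler_norm _)).
Qed.

(** In a partial sum only indices in the support of [z] count, and [h] sends them to distinct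
    indices; so it is at most the [p]-th power of [K] times a sum of distinct terms of the series of
    [u]. *)
Lemma lp_dominates (R : realType) (p : R) (p1 : 1 <= p)
    (Y X : completeNormedModType R) :
  dominates (@lp_val R p p1 Y) (@lp_val R p p1 X).
Proof.
move=> u z h K K0 hinj zu; have p0 : 0 < p by exact: (lt_le_trans ltr01 p1).
apply: lp_sum_of_series_le; first by rewrite mulr_ge0.
apply: lime_le.
  by apply: is_cvg_nneseries => *; rewrite lee_fin powR_ge0.
apply: nearW => N; rewrite powRM// EFinM lp_norm_powR.
rewrite (bigID (fun n => z n != 0)) /= [X in (_ + X)%E]big1 ?adde0; last first.
  by move=> n /negPn/eqP ->; rewrite normr0 powR0// gt_eqF.
have zle : (\sum_(0 <= n < N | z n != 0%R) (`|z n| `^ p)%:E <=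
    \sum_(0 <= n < N | z n != 0%R) ((K `^ p)%:E * (`|u (h n)| `^ p)%:E))%E.
  apply: lee_sum => n _; rewrite -EFinM lee_fin -powRM//.
  by rewrite ge0_ler_powR ?nnegrE ?mulr_ge0 ?(ltW p0).
apply: (le_trans zle); rewrite -ge0_sume_distrr; last first.
  by move=> *; rewrite lee_fin powR_ge0.
rewrite lee_wpmul2l ?lee_fin ?powR_ge0//.
rewrite -big_filter -(big_map h xpredT (fun j => (`|u j| `^ p)%:E)).
apply: sum_uniq_le_nneseries => [n|]; first by rewrite lee_fin powR_ge0.
rewrite map_inj_in_uniq ?filter_uniq ?iota_uniq//.
by move=> i j; rewrite !mem_filter => /andP[zi _] /andP[zj _]; exact: hinj.
Qed.

Lemma c0_sum_of_le (R : realType) (X : completeNormedModType R)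
    (z : nat -> X) (K : R) : z n @[n --> \oo] --> (0 : X) ->
  (forall n, `|z n| <= K) -> exists2 v : c0_sum X, `|v| <= K & c0_val v =1 z.
Proof.
move=> z0 zK; have zin : z \in @c0_seq R X by exact/asboolP.
exists (C0Sum zin) => //; apply: ge_sup; first by exists `|z 0|; exists 0%N.
by move=> _ [n _ <-].
Qed.

Lemma c0_sequence_space (R : realType) (Y : completeNormedModType R) :
  sequence_space (@c0_val R Y).
Proof.
have ucvg (u : c0_sum Y) : u n @[n --> \oo] --> (0 : Y).
  by case: u => u /= /asboolP.
split.
- by [].
- by move=> u v uv; apply/val_inj/funext.
- move=> u n; apply: sup_upper_bound; last by exists n.
  split; first by exists `|u 0|; exists 0%N.
  have /cvg_seq_bounded[M [_ My]] : cvg (u n @[n --> \oo]).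
    by apply/cvg_ex; exists 0; exact: ucvg.
  by exists (M + 1) => _ [m _ <-]; apply: My => //; rewrite ltrDl.
- move=> n a; apply: c0_sum_of_le; last by move=> m; case: eqP; rewrite ?normr0.
  apply/cvgr0Pnorm_le => e e0; exists n.+1 => // m /= nm.
  by rewrite gtn_eqF// normr0 ltW.
- move=> u e e0; have /cvgr0Pnorm_le uc := ucvg u.
  have [k _ uk] := uc e e0; exists k; apply: c0_sum_of_le.
    apply/cvgr0Pnorm_le => d d0; apply: filterS (uc d d0) => n un.
    by case: ifP => // _; rewrite normr0 ltW.
  by move=> n; case: ltnP => [_|/uk//]; rewrite normr0 ltW.
Qed.

(** Each value is taken at most once on [P], so the induction on [J] only has to pass the one index
    of value [J]. *)
Lemma injective_on_tendsto (P : pred nat) (h : nat -> nat) :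
  {in P &, injective h} ->
  forall J, exists N, forall n, (N <= n)%N -> P n -> (J <= h n)%N.
Proof.
move=> hinj; elim=> [|J [N IH]]; first by exists 0%N.
case: (pselect (exists2 m, P m & h m = J)) => [[m Pm hm]|noJ].
  exists (maxn N m.+1) => n; rewrite geq_max => /andP[Nn mn] Pn.
  rewrite ltn_neqAle IH// andbT; apply/eqP => hn.
  by move: mn; rewrite (hinj m n Pm Pn) ?ltnn// hm.
exists N => n Nn Pn; rewrite ltn_neqAle IH// andbT; apply/eqP => hn.
by apply: noJ; exists n.
Qed.

(** The norm bound is pointwise; convergence to 0 holds because [h] tends to infinity along the
    support of [z]. *)
Lemma c0_dominates (R : realType) (Y X : completeNormedModType R) :
  dominates (@c0_val R Y) (@c0_val R X).
Proof.
move=> u z h K K0 hinj zu; apply: c0_sum_of_le; last first.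
  move=> n; apply: le_trans (zu n) _; apply: ler_wpM2l => //.
  exact: (coord_le (c0_sequence_space Y)).
apply/cvgr0Pnorm_le => e e0.
have K1 : 0 < K + 1 by rewrite ltr_wpDl.
have /cvgr0Pnorm_le/(_ (e / (K + 1))) : u n @[n --> \oo] --> (0 : Y).
  by case: u {zu} => u /= /asboolP.
rewrite divr_gt0// => /(_ isT)[J _ uJ].
have [N zN] := injective_on_tendsto hinj J.
exists N => // n /= Nn; have [->|zn] := eqVneq (z n) 0.
  by rewrite normr0 ltW.
apply: le_trans (zu n) _.
apply: (@le_trans _ _ ((K + 1) * `|u (h n)|)).
  by apply: ler_wpM2r => //; rewrite lerDl.
by rewrite mulrC -ler_pdivlMr//; apply: uJ; exact: zN.
Qed.

(** * Diagonal, interleaved and shear operators; compression *)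

(** Domination yields each image with its norm bound; linearity follows because the coordinates
    determine a vector. Outside [P] the image vanishes, so [h] has to be injective on [P] only. *)
Lemma diagonal_op (R : realType) (Y X EY EX : normedModType R)
    (cY : EY -> nat -> Y) (cX : EX -> nat -> X) (L : nat -> Y -> X)
    (P : pred nat) (h : nat -> nat) (K : R) :
  sequence_space cY -> sequence_space cX ->
  dominates cY cX -> 0 <= K -> {in P &, injective h} ->
  (forall n, linear (L n)) -> (forall n y, `|L n y| <= K * `|y|) ->
  (forall n y, ~~ P n -> L n y = 0) ->
  exists T : EY -> EX, [/\ linear T, forall u, `|T u| <= K * `|u| &
    forall u n, cX (T u) n = L n (cY u (h n))].
Proof.
move=> sY sX dYX K0 hinj Ll LK LP.
have /choice[T TP] : forall u : EY, exists v : EX, `|v| <= K * `|u| /\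
    forall n, cX v n = L n (cY u (h n)).
  move=> u; have [||v vu vE] := dYX u (fun n => L n (cY u (h n))) h K K0.
  - move=> i j; rewrite !inE => Li Lj; apply: hinj; rewrite unfold_in.
      by apply: contraNT Li => /LP ->.
    by apply: contraNT Lj => /LP ->.
  - by move=> n; exact: LK.
  - by exists v.
exists T; split=> [a u v|u|u]; [|exact: (TP u).1|exact: (TP u).2].
apply: (coord_inj sX) => n.
by rewrite (coord_linear sX) !(TP _).2 (coord_linear sY) Ll.
Qed.

Lemma half_inj_odd : {in odd &, injective half}.
Proof.
move=> i j oi oj ij; have {}oi : odd i := oi; have {}oj : odd j := oj.
by rewrite -(odd_double_half i) -(odd_double_half j) oi oj ij.
Qed.

Lemma half_inj_even : {in predC odd &, injective half}.
Proof.
move=> i j; rewrite !inE => oi oj ij.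
have /negbTE{}oi : ~~ odd i := oi; have /negbTE{}oj : ~~ odd j := oj.
by rewrite -(odd_double_half i) -(odd_double_half j) oi oj ij.
Qed.

(* [F] sends [u] to the sequence [U u_0, W_0 u_0, U u_1, W_1 u_1, ...]. *)
Definition interleaved (R : realType) (Y X EY EX : normedModType R)
    (cY : EY -> nat -> Y) (cX : EX -> nat -> X) (U : Y -> X)
    (W : nat -> Y -> X) (F : EY -> EX) :=
  forall u m, cX (F u) m =
    if odd m then W m./2 (cY u m./2) else U (cY u m./2).

(** [F] is the sum of two diagonal operators, one filling the even places and one the odd places;
    [half] is injective on each of the two sets. *)
Lemma interleaved_op (R : realType) (Y X EY EX : normedModType R)
    (cY : EY -> nat -> Y) (cX : EX -> nat -> X) (U : Y -> X)
    (W : nat -> Y -> X) (M : R) :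
  sequence_space cY -> sequence_space cX ->
  dominates cY cX -> 0 <= M -> bounded_op U ->
  (forall n, linear (W n)) -> (forall n y, `|W n y| <= M * `|y|) ->
  exists2 F : EY -> EX, bounded_op F & interleaved cY cX U W F.
Proof.
move=> sY sX dYX M0 [Ul [K UK]] Wl WM.
have [||m y|F1 [F1l F1K F1E]] := diagonal_op
    (L := fun m y => if odd m then 0 else U y) sY sX dYX
    (normr_ge0 K) half_inj_even.
- by move=> m a y z; case: ifP => _; [rewrite scaler0 addr0|exact: Ul].
- move=> m y; case: ifP => _; first by rewrite normr0 mulr_ge0.
  by apply: le_trans (UK y) _; rewrite ler_wpM2r// ler_norm.
- by rewrite /= negbK => ->.
have [||m y|F2 [F2l F2K F2E]] := diagonal_op
    (L := fun m y => if odd m then W m./2 y else 0) sY sX dYX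
    M0 half_inj_odd.
- by move=> m a y z; case: ifP => _; [exact: Wl|rewrite scaler0 addr0].
- by move=> m y; case: ifP => _ //; rewrite normr0 mulr_ge0.
- by move=> /negbTE ->.
exists (fun u => F1 u + F2 u); last first.
  move=> u m; rewrite (linear_propD (coord_linear sX m)) F1E F2E.
  by case: ifP; rewrite ?add0r ?addr0.
split; first by move=> a u v; rewrite F1l F2l scalerDr addrACA.
exists (`|K| + M) => u; rewrite mulrDl (le_trans (ler_normD _ _))//.
exact: lerD.
Qed.

(** The even places of [F u] hold the values of [U], so the lower bound of [U] and domination along
    [double] bound [F] below. Finitely many vectors completing the range of [F] would give, at place
    0, finitely many completing that of [U]. *)
Lemma interleaved_Emb (R : realType) (Y X : normedModType R)
    (EY : completeNormedModType R) (EX : normedModType R)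
    (cY : EY -> nat -> Y) (cX : EX -> nat -> X) (U : Y -> X)
    (W : nat -> Y -> X) (F : EY -> EX) :
  sequence_space cY -> sequence_space cX ->
  dominates cX cY -> Emb Y X U ->
  bounded_op F -> interleaved cY cX U W F -> Emb EY EX F.
Proof.
move=> sY sX dXY UE Fb FE.
have [K K0 UK] := Emb_bounded_below UE.
apply: (Emb_of_bounded_below (K := K)) => // [u|s codim].
  have [|m|v vu vE] := dXY (F u) (cY u) double K (ltW K0).
  - by move=> i j _ _; exact: double_inj.
  - by rewrite FE odd_double doubleK.
  - by move: vu; rewrite (coord_inj sY _ _ vE).
case: UE => _ _ _ /(_ [seq cX v 0%N | v <- s]); apply => x.
have [v _ vE] := coord_single sX 0%N x.
have [_ [u _ <-] [a va]] := codim v.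
exists (U (cY u 0%N)); first by exists (cY u 0%N).
exists a; have := vE 0%N; rewrite eqxx => <-.
rewrite va (linear_propD (coord_linear sX 0%N)) FE /=; congr (_ + _).
rewrite size_map.
have cl := coord_linear sX 0%N.
rewrite (big_morph (cX^~ 0%N) (linear_propD cl)
  (linear_prop0 cl)).
apply: eq_bigr => i _; rewrite (linear_propZ _ cl).
by rewrite (nth_map 0).
Qed.

(* Invertibility needs no smallness: the matrix of the operator is unipotent. *)
Lemma shear_op (R : realType) (X EX : normedModType R)
    (cX : EX -> nat -> X) (S : nat -> X -> X) (K : R) :
  sequence_space cX -> dominates cX cX -> 0 <= K ->
  (forall n, linear (S n)) -> (forall n x, `|S n x| <= K * `|x|) ->
  exists2 A : EX -> EX, GL A &
    forall u m, cX (A u) m =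
      cX u m + if odd m then S m./2 (cX u m.-1) else 0.
Proof.
move=> sX dXX K0 Sl SK.
have pinj : {in odd &, injective predn}.
  by move=> [//|i] [//|j] _ _ /= ->.
have [||m x|N [Nl NK NE]] := diagonal_op
    (L := fun m x => if odd m then S m./2 x else 0) sX sX dXX
    K0 pinj.
- by move=> m a y z; case: ifP => _; [exact: Sl|rewrite scaler0 addr0].
- by move=> m y; case: ifP => _ //; rewrite normr0 mulr_ge0.
- by move=> /negbTE ->.
(* [N] writes at odd places and reads even ones, so its square is 0, and [1 + N] and [1 - N] are
   inverse to each other. *)
have NN u : N (N u) = 0.
  apply: (coord_inj sX) => m.
  rewrite NE NE (linear_prop0 (coord_linear sX m)).
  case: ifP => //; case: m => //= m /negbTE ->.
  exact: (linear_prop0 (Sl _)).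
have Nb (e : R) : `|e| = 1 -> bounded_op (fun u => u + e *: N u).
  move=> e1; split=> [a u v|].
    by rewrite Nl !scalerDr !scalerA mulrC addrACA.
  exists (1 + K) => u; rewrite mulrDl mul1r (le_trans (ler_normD _ _))//.
  by rewrite lerD// normrZ e1 mul1r.
have Nc (e d : R) : e + d = 0 ->
    cancel (fun u => u + e *: N u) (fun u => u + d *: N u).
  move=> ed u; rewrite /= (linear_propD Nl) (linear_propZ _ Nl).
  by rewrite NN scaler0 addr0 -addrA -scalerDl ed scale0r addr0.
exists (fun u => u + 1 *: N u); last first.
  move=> u m; rewrite (linear_propD (coord_linear sX m)) scale1r.
  by rewrite NE.
exists (fun u => u + (-1) *: N u); split.
- by apply: Nb; rewrite normr1.
- by apply: Nb; rewrite normrN1.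
- by apply: Nc; rewrite subrr.
- by apply: Nc; rewrite addNr.
Qed.

(** [T] is the entry of [A] from place [2n] to place [2n+1]: [J x] puts [x] at place [2n], and place
    [2n+1] of its image under [A] is read off. *)
Lemma interleaved_compression (R : realType) (Y X EY EX : normedModType R)
    (cY : EY -> nat -> Y) (cX : EX -> nat -> X) (U : Y -> X)
    (W W' : nat -> Y -> X) (F F' : EY -> EX) (A : EX -> EX) (K : R) (n : nat) :
  sequence_space cY -> sequence_space cX -> linear U ->
  (forall m, linear (W m)) ->
  interleaved cY cX U W F ->
  interleaved cY cX U W' F' ->
  linear A -> 0 <= K -> (forall u, `|A u| <= K * `|u|) ->
  (forall u, A (F u) = F' u) -> (forall y, W n y = 0) ->
  exists T : X -> X, [/\ linear T, forall x, `|T x| <= K * `|x| &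
    forall y, T (U y) = W' n y].
Proof.
move=> sY sX Ul Wl FE F'E Al K0 AK AF Wn.
have /choice[J JP] : forall x : X, exists v : EX, `|v| <= `|x| /\
    forall m, cX v m = if m == n.*2 then x else 0.
  by move=> x; have [v] := coord_single sX n.*2 x; exists v.
exists (fun x => cX (A (J x)) n.*2.+1); split.
- move=> a x y; rewrite -(coord_linear sX) -Al; congr (cX (A _) _).
  apply: (coord_inj sX) => m; rewrite (coord_linear sX) !(JP _).2.
  by case: ifP => // _; rewrite scaler0 addr0.
- move=> x; apply: le_trans (coord_le sX _ _) _; apply: le_trans (AK _) _.
  by rewrite ler_wpM2l// (JP x).1.
move=> y; have [v _ vE] := coord_single sY n y.
(* As [v] is [y] alone at place [n], [F v] has [U y] at place [2n] and, since [W n] vanishes, 0 at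
   place [2n+1]. *)
have -> : J (U y) = F v.
  apply: (coord_inj sX) => m; rewrite (JP _).2 FE vE.
  rewrite -{1}(odd_double_half m); case: (odd m) => /=.
    rewrite add1n; have -> : (m./2.*2.+1 == n.*2) = false.
      by apply/negP => /eqP/(congr1 odd); rewrite /= !odd_double.
    case: eqP => [->|_]; first by rewrite Wn.
    by rewrite (linear_prop0 (Wl _)).
  rewrite add0n (inj_eq double_inj); case: ifP => // _.
  by rewrite (linear_prop0 Ul).
by rewrite AF F'E /= odd_double /= uphalf_double vE eqxx.
Qed.

(** * Continuity in the bits and Borel measurability *)

Lemma norm_natr_boolB (R : realType) (b b' : bool) :
  `|b%:R - b'%:R| <= 1 :> R.
Proof.
by case: b; case: b'; rewrite /= ?subrr ?subr0 ?sub0r ?normrN ?normr0 ?normr1.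
Qed.

(** When [b] and [b'] agree below [k], the two images of [u] differ only through the tail of [u]
    from [k] on, which is small. *)
Lemma interleaved_continuous (R : realType) (Y X EY EX : normedModType R)
    (cY : EY -> nat -> Y) (cX : EX -> nat -> X) (U : Y -> X)
    (V : nat -> Y -> X) (M : R) (F : (nat -> bool) -> EY -> EX) :
  sequence_space cY -> sequence_space cX ->
  dominates cY cX -> 0 <= M ->
  (forall n y, `|V n y| <= M * `|y|) ->
  (forall b : nat -> bool, interleaved cY cX U
     (fun n y => (b n)%:R *: V n y) (F b)) ->
  forall b u e, 0 < e -> exists k, forall b',
    (forall n, (n < k)%N -> b' n = b n) -> `|F b u - F b' u| <= e.
Proof.
move=> sY sX dYX M0 VM FE b u e e0.
have M1 : 0 < M + 1 by rewrite ltr_wpDl.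
(* Dividing by [M + 1] rather than by [M] covers the case [M = 0]. *)
have [|k [v ve vE]] := coord_tail sY u (e / (M + 1)); first by rewrite divr_gt0.
exists k => b' bb'.
pose z m := if odd m then ((b m./2)%:R - (b' m./2)%:R) *: V m./2 (cY u m./2)
  else 0.
have [i j|m|w wv wE] := dYX v z half M M0.
- rewrite !inE /z => zi zj; apply: half_inj_odd.
    by apply: contraNT zi => /negbTE oi; rewrite ifF.
  by apply: contraNT zj => /negbTE oj; rewrite ifF.
- rewrite /z vE; case: ifP => _; last by rewrite normr0 mulr_ge0.
  case: ltnP => [mk|_]; first by rewrite bb'// subrr scale0r !normr0 mulr0.
  rewrite normrZ; apply: le_trans (VM _ _).
  by apply: ler_piMl => //; exact: norm_natr_boolB.
have -> : F b u - F b' u = w.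
  apply: (coord_inj sX) => m; rewrite wE (linear_propB (coord_linear sX m)).
  by rewrite !FE /z; case: ifP => _; rewrite ?subrr// scalerBl.
apply: le_trans wv _; apply: le_trans (ler_wpM2l M0 ve) _.
by rewrite mulrCA ler_piMr ?(ltW e0)// ler_pdivrMr// mul1r lerDl.
Qed.

(** The preimage of an open set is a union of cylinders given by finite words of bits, and there are
    countably many such words. *)
Lemma borel_fun_of_bits (T U : topologicalType) (beta : T -> nat -> bool)
    (g : (nat -> bool) -> U) :
  (forall n, borel_set [set x | beta x n]) ->
  (forall (O : set U) b, open O -> O (g b) -> exists k, forall b',
     (forall n, (n < k)%N -> b' n = b n) -> O (g b')) ->
  borel_fun (fun x => g (beta x)).
Proof.
move=> betaB gc.
have SA : sigma_algebra setT (@borel_set T) := smallest_sigma_algebra _ _.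
have [BT BD _ BI] := (sigma_algebraP (fun X _ => @subsetT _ X)).1 SA.
have betaE n (c : bool) : borel_set [set x | beta x n = c].
  case: c; first exact: betaB.
  have -> : [set x | beta x n = false] = setT `\` [set x | beta x n].
    apply/seteqP; split => x /=; first by move=> ->.
    by case=> _; case: (beta x n).
  by case: SA => _ + _; apply; exact: betaB.
have cylB (t : nat -> bool) k :
    borel_set [set x | forall n, (n < k)%N -> beta x n = t n].
  elim: k => [|k IH].
    rewrite (_ : [set x | _] = setT)//.
    by apply/seteqP; split.
  rewrite (_ : [set x | _] = [set x | forall n, (n < k)%N -> beta x n = t n]
      `&` [set x | beta x k = t k]); first exact: BI.
  apply/seteqP; split => x /=.
    by move=> xt; split => [n nk|]; apply: xt => //; exact: ltnW.
  by move=> [xt xk] n; rewrite ltnS leq_eqVlt => /predU1P[->|/xt].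
have opB (O : set U) : open O -> borel_set ((fun x => g (beta x)) @^-1` O).
  move=> Oop.
  (* When [m] codes a word [s], [A m] is its cylinder if [g] maps all continuations of [s] into [O],
     and is empty otherwise. *)
  pose A m := if unpickle m is Some s then
    [set x | (forall n, (n < size s)%N -> beta x n = nth false s n) /\
      forall b', (forall n, (n < size s)%N -> b' n = nth false s n) ->
        O (g b')] else set0.
  have -> : (fun x => g (beta x)) @^-1` O = \bigcup_m A m.
    apply/seteqP; split => x /=.
      move=> /(gc _ _ Oop)[k kO]; exists (pickle (mkseq (beta x) k)) => //.
      rewrite /A pickleK /= size_mkseq; split=> [n nk|b' b'x].
        by rewrite nth_mkseq.
      by apply: kO => n nk; rewrite b'x// nth_mkseq.
    by case=> m _; rewrite /A; case: unpickle => // s [xs]; exact.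
  case: SA => _ _; apply => m; rewrite /A; case: unpickle => [s|]; last first.
    exact: sigma_algebra0.
  case: (pselect (forall b',
      (forall n, (n < size s)%N -> b' n = nth false s n) -> O (g b'))) => sO.
    rewrite (_ : [set x | _] =
      [set x | forall n, (n < size s)%N -> beta x n = nth false s n])//.
    by apply/seteqP; split => x /=; [case|move=> xs; split].
  rewrite (_ : [set x | _] = set0); first exact: sigma_algebra0.
  by apply/seteqP; split => x //= -[_ /sO].
(* The sets with Borel preimage form a sigma-algebra, so open sets suffice. *)
move=> B BB.
have := smallest_sub (sigma_algebra_image (fun x => g (beta x)) SA) _ BB.
rewrite /image_set_system /= setTI; apply => O Oop.
by rewrite /= setTI; exact: opB.
Qed.

(** The sets of sequences sharing a given prefix with [b] form a filter base, along which pointwise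
    convergence is convergence in the topology inherited by [Emb Y X]. *)
Lemma open_Emb_of_pointwise (R : realType) (Y X : normedModType R)
    (g : (nat -> bool) -> Emb Y X) :
  (forall b y e, 0 < e -> exists k, forall b',
    (forall n, (n < k)%N -> b' n = b n) ->
    `|\val (g b) y - \val (g b') y| <= e) ->
  forall (O : set (Emb Y X)) b, open O -> O (g b) -> exists k, forall b',
    (forall n, (n < k)%N -> b' n = b n) -> O (g b').
Proof.
move=> gc O b [A Aop <-] Ab.
pose N k := [set b' : nat -> bool | forall n, (n < k)%N -> b' n = b n].
pose G := filter_from [set: nat] N.
have GF : Filter G.
  apply: filter_fromT_filter; first by exists 0%N.
  move=> i j; exists (maxn i j) => b' b'b; split => n nk; apply: b'b.
    by rewrite leq_max nk.
  by rewrite leq_max nk orbT.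
have cv : (\val (g b') : {ptws Y -> X}) @[b' --> G] -->
    (\val (g b) : {ptws Y -> X}).
  apply: (@pointwise_cvgP Y X (fmap (fun b' => \val (g b')) G)
    (\val (g b)) _).2 => y.
  apply/cvgrPdist_le => e e0; have [k kg] := gc b y e e0.
  by exists k.
have : nbhs (\val (g b) : {ptws Y -> X}) A by exact: open_nbhs_nbhs.
by move=> /cv[k _ kA]; exists k => b' b'b; exact: kA.
Qed.

(** * Coding sequences of reals by rational cuts *)

(** The default 0 is harmless: [cut_bit] is constantly false at numbers that code no pair. *)
Definition cut_index (n : nat) : nat :=
  if (unpickle n : option (nat * rat)) is Some (i, _) then i else 0%N.

Definition cut_bit (R : realType) (x : nat -> R) (n : nat) : bool :=
  if unpickle n is Some (i, q) then x i < ratr q else false.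

Lemma cut_bit_borel (R : realType) (n : nat) :
  borel_set [set x : {ptws nat -> R} | cut_bit x n].
Proof.
rewrite /cut_bit; case: unpickle => [[i q]|]; last first.
  rewrite (_ : [set _ | _] = set0); first exact: sigma_algebra0.
  by apply/seteqP; split => x.
apply: sub_sigma_algebra.
have op : open ((fun x : {ptws nat -> R} => x i) @^-1`
    [set t : R | t < ratr q]).
  apply: open_comp; last exact: open_lt.
  by move=> x _; exact: (@proj_continuous nat (fun=> R) i x).
exact: op.
Qed.

Lemma cut_bit_eq (R : realType) (x y : nat -> R) (n : nat) :
  x (cut_index n) = y (cut_index n) -> cut_bit x n = cut_bit y n.
Proof.
by rewrite /cut_index /cut_bit; case: unpickle => [[i q]|//] ->.
Qed.

(** A rational strictly between the two reals separates their cuts. *)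
Lemma cut_bit_neq (R : realType) (x y : nat -> R) (i : nat) :
  x i <> y i -> exists2 n, cut_index n = i & cut_bit x n != cut_bit y n.
Proof.
wlog xy : x y / x i < y i.
  move=> H /eqP; rewrite neq_lt => /orP[xy|yx].
    by apply: H => //; apply/eqP; rewrite lt_eqF.
  have [|n ni yxn] := H y x yx; first by apply/eqP; rewrite lt_eqF.
  by exists n => //; rewrite eq_sym.
move=> _; have [q] := rat_in_itvoo xy; rewrite in_itv /= => /andP[xq qy].
exists (pickle (i, q)); rewrite /cut_index /cut_bit pickleK//.
by rewrite xq ltNge (ltW qy).
Qed.

(** * The reduction of E_1 *)

(** The hypotheses on [U] and [V] are what (a), (b) and (c) provide. The three dominations serve, in
    this order, to build the operators, to build the shear and to bound the operators below. *)
Lemma E1_reducible_sequence_space (R : realType) (Y X : normedModType R)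
    (EY : completeNormedModType R) (EX : normedModType R)
    (cY : EY -> nat -> Y) (cX : EX -> nat -> X)
    (U : Y -> X) (V : nat -> Y -> X) (M : R) :
  sequence_space cY -> sequence_space cX ->
  dominates cY cX -> dominates cX cX ->
  dominates cX cY ->
  Emb Y X U -> 0 <= M -> (forall i, linear (V i)) ->
  (forall i y, `|V i y| <= M * `|y|) ->
  (forall i, exists2 T : X -> X, bounded_op T & forall y, T (U y) = V i y) ->
  (forall K : R, exists N, forall i, (N <= i)%N -> ~ exists T : X -> X,
    [/\ linear T, forall x, `|T x| <= K * `|x| & forall y, T (U y) = V i y]) ->
  borel_reducible (@E1 R) (@emb_equiv R EY EX).
Proof.
move=> sY sX dYX dXX dXY UE M0 Vl VM UV UVn.
have Ub : bounded_op U by case: UE.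
pose W (b : nat -> bool) n y := (b n)%:R *: V (cut_index n) y.
have Wl b n : linear (W b n).
  by move=> a y z; rewrite /W Vl scalerDr !scalerA mulrC.
have /choice[F FP] : forall b, exists F : EY -> EX, bounded_op F /\
    interleaved cY cX U (W b) F.
  move=> b.
  have [||F Fb FE] := interleaved_op (W := W b) sY sX dYX M0 Ub.
  - exact: Wl.
  - move=> n y; rewrite normrZ; apply: le_trans (VM (cut_index n) y).
    by rewrite ler_piMl//; case: (b n); rewrite ?normr1 ?normr0.
  - by exists F.
have FE b : Emb EY EX (F b).
  by apply: (interleaved_Emb (W := W b)) sY sX dXY UE _ _;
    have [] := FP b.
pose g b : Emb EY EX := SigSub (mem_set (FE b)).
exists (fun x => g (cut_bit x)); split.
  apply: borel_fun_of_bits => [n|]; first exact: cut_bit_borel.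
  apply: open_Emb_of_pointwise => b u e e0.
  apply: (interleaved_continuous (U := U) (V := V \o cut_index) (F := F) sY sX
    dYX M0) e0 => [n y|].
    exact: VM.
  by move=> b'; have [] := FP b'.
move=> x y; split=> [[N xyN]|[A [B [[Al [KA AK]] [Bl [KB BK]] AB BA]] xAy]].
  have /choice[T TP] : forall i, exists T : X -> X, bounded_op T /\
      forall y, T (U y) = V i y.
    by move=> i; have [T] := UV i; exists T.
  have /choice[K KP] : forall i, exists K : R, forall z, `|T i z| <= K * `|z|.
    by move=> i; have [[_ [K KT]] _] := TP i; exists K.
  pose S n z := ((cut_bit x n)%:R - (cut_bit y n)%:R) *: T (cut_index n) z.
  (* [S n] vanishes once [cut_index n] is at least [N], so the finitely many constants [K i] with
     [i < N] bound all the entries. *)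
  have K0 : 0 <= \sum_(i < N) `|K i| by apply: sumr_ge0.
  have [||A AGL AE] := shear_op (S := S) sX dXX K0.
  - move=> n a z z'; have [[Tl _] _] := TP (cut_index n).
    by rewrite /S Tl scalerDr !scalerA mulrC.
  - move=> n z; rewrite /S.
    have [Nn|nN] := leqP N (cut_index n).
      by rewrite (cut_bit_eq (xyN _ Nn)) subrr scale0r normr0 mulr_ge0.
    rewrite normrZ; apply: (@le_trans _ _ `|T (cut_index n) z|).
      by rewrite ler_piMl// norm_natr_boolB.
    apply: le_trans (KP _ _) _; rewrite ler_wpM2r//.
    apply: le_trans (ler_norm _) _.
    by rewrite (bigD1 (Ordinal nN))//= lerDl sumr_ge0.
  exists A => //; apply/funext => u /=.
  apply: (coord_inj sX) => m; rewrite AE.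
  have [_ FxE] := FP (cut_bit x); have [_ FyE] := FP (cut_bit y).
  rewrite FxE !FyE; case: ifP => om; last by rewrite addr0.
  (* The place before an odd one is even and has the same half, so [S] acts there on the value of
     [U] at the same coordinate of [u], which [T] turns into that of [V]. *)
  have [m1 m2] : odd m.-1 = false /\ m.-1./2 = m./2.
    by case: m om => //= m /negbTE om; rewrite uphalf_half om.
  rewrite m1 m2 /S /W (TP _).2 -scalerDl; congr (_ *: _).
  by rewrite addrC subrK.
(* One constant serves [A] and its inverse [B]: which of them is compressed depends on which of the
   two bits is 0. *)
pose K := `|KA| + `|KB|; have K0 : 0 <= K by rewrite addr_ge0.
have {}AK u : `|A u| <= K * `|u|.
  apply: le_trans (AK u) _; rewrite ler_wpM2r//.
  by apply: le_trans (ler_norm _) _; rewrite lerDl.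
have {}BK u : `|B u| <= K * `|u|.
  apply: le_trans (BK u) _; rewrite ler_wpM2r//.
  by apply: le_trans (ler_norm _) _; rewrite lerDr.
have AF u : A (F (cut_bit y) u) = F (cut_bit x) u.
  by have := congr1 (@^~ u) xAy.
have BF u : B (F (cut_bit x) u) = F (cut_bit y) u by rewrite -AF AB.
(* From [N] on no operator bounded by [K] carries [U] to [V i]; a difference between [x i] and [y i]
   would yield one. *)
have [N NP] := UVn K; exists N => i Ni.
apply: contrapT => /cut_bit_neq[n ni xyn].
apply: (NP i Ni); rewrite -ni.
have [Ul _] := Ub.
have [_ FxE] := FP (cut_bit x); have [_ FyE] := FP (cut_bit y).
have WE (b : nat -> bool) : b n -> forall y, W b n y = V (cut_index n) y.
  by rewrite /W => -> y'; rewrite scale1r.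
have W0 (b : nat -> bool) : ~~ b n -> forall y, W b n y = 0.
  by rewrite /W => /negbTE -> y'; rewrite scale0r.
case xn : (cut_bit x n) xyn; case yn : (cut_bit y n) => // _.
- have [T [Tl TK TU]] := interleaved_compression (n := n)
    sY sX Ul (Wl _) FyE FxE Al K0 AK AF (W0 _ (negbT yn)).
  by exists T; split => // z; rewrite TU WE.
- have [T [Tl TK TU]] := interleaved_compression (n := n)
    sY sX Ul (Wl _) FxE FyE Bl K0 BK BF (W0 _ (negbT xn)).
  by exists T; split => // z; rewrite TU WE.
Qed.

Theorem proposition2p10 (R : realType) (p : R) (p1 : 1 <= p)
    (Y X : completeNormedModType R)
    (sepY : separable_space Y) (sepX : separable_space X)
    (infY : infinite_dim Y) (infX : infinite_dim X)
    (r : cantor_space -> Emb Y X)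
    (r_red : borel_reduction E0 (@emb_equiv R Y X) r)
    (r_bounded : exists M : R, forall a, op_norm (\val (r a)) <= M)
    (r_E0k : exists c : nat -> nat, forall k (a b : cantor_space),
       E0k k a b -> emb_equivn (c k) (r a) (r b))
    (r_nE0k : exists d : nat -> int,
       (d k)%:~R @[k --> \oo] --> (+oo : set_system R) /\
       forall k (a b : cantor_space), ~ E0k k a b ->
         (exists i, [/\ (k <= i)%N, a i = false & b i = true]) ->
         ~ exists T : X -> X, [/\ bounded_op T, op_norm T < (d k)%:~R &
             T \o \val (r a) = \val (r b)]) :
  borel_reducible (@E1 R) (@emb_equiv R (lp_sum p1 Y) (lp_sum p1 X)) /\
  borel_reducible (@E1 R) (@emb_equiv R (c0_sum Y) (c0_sum X)).
Proof.
have [M rM] := r_bounded; have [c rc] := r_E0k; have [d [doo rd]] := r_nE0k.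
pose zero : cantor_space := fun=> false.
pose delta i : cantor_space := fun j => j == i.
have rE a : Emb Y X (\val (r a)) by exact: set_mem (valP (r a)).
have rb a : bounded_op (\val (r a)) by case: (rE a).
have rl a : linear (\val (r a)) by case: (rb a).
have rMn a y : `|\val (r a) y| <= `|M| * `|y|.
  apply: le_trans (le_op_norm _ (rb a)) _.
  by rewrite ler_wpM2r// (le_trans (rM a))// ler_norm.
have rT i : exists2 T : X -> X, bounded_op T &
    forall y, T (\val (r zero) y) = \val (r (delta i)) y.
  (* [zero] and [delta i] differ at place [i] only, so they agree from [i.+1] on. *)
  have [|T [T' [[Tb _ _ _] TE _]]] := rc i.+1 zero (delta i).
    by move=> j ij; rewrite /delta gtn_eqF.
  by exists T => // y; have := congr1 (@^~ y) TE.
have rTn (K : R) : exists N, forall i, (N <= i)%N -> ~ exists T : X -> X,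
    [/\ linear T, forall x, `|T x| <= K * `|x| &
      forall y, T (\val (r zero) y) = \val (r (delta i)) y].
  (* From [N] on [d i] exceeds the absolute value of [K], which bounds the norm of [T]. *)
  have [N _ NP] := (cvgryPgt _).1 doo `|K|.
  exists N => i Ni [T [Tl TK TE]].
  (* Hypothesis (c) is used at level [i] itself: the values 0 and 1 at place [i] both refute [E0k i]
     and give the required pair of bits. *)
  apply: (rd i zero (delta i)).
  - by move=> /(_ i (leqnn i)); rewrite /zero /delta eqxx.
  - by exists i; rewrite /delta eqxx.
  - exists T; split.
    + by split => //; exists K.
    + apply: le_lt_trans (NP i Ni); apply: op_norm_le => // x.
      by apply: le_trans (TK x) _; rewrite ler_wpM2r// ler_norm.
    + exact/funext.
split.
- exact: (E1_reducible_sequence_space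
    (@lp_sequence_space _ _ p1 Y) (@lp_sequence_space _ _ p1 X)
    (@lp_dominates _ _ p1 Y X) (@lp_dominates _ _ p1 X X)
    (@lp_dominates _ _ p1 X Y)
    (rE zero) (normr_ge0 M) (fun i => rl (delta i)) (fun i => rMn (delta i))
    rT rTn).
- exact: (E1_reducible_sequence_space
    (@c0_sequence_space _ Y) (@c0_sequence_space _ X)
    (@c0_dominates _ Y X) (@c0_dominates _ X X)
    (@c0_dominates _ X Y)
    (rE zero) (normr_ge0 M) (fun i => rl (delta i)) (fun i => rMn (delta i))
    rT rTn).
Qed.
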